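(* Let $\mathcal{H}_1,\mathcal{H}_2$ be right quaternionic Hilbert spaces, $K_1 \in \mathbb{B}(\mathcal{H}_1)$ and $K_2 \in \mathbb{B}(\mathcal{H}_2)$. Let $\{u_i\}_{i \in I}$ be a $K_1$-frame for $\mathcal{H}_1$ with a $K_1$-dual frame $\{a_i\}_{i \in I}$, and let $\{v_i\}_{i \in I}$ be a $K_2$-frame for $\mathcal{H}_2$ with a $K_2$-dual frame $\{b_i\}_{i \in I}$. Let $T_1$ and $T_2$ be the synthesis operators of $\{u_i\}_{i \in I}$ and $\{v_i\}_{i \in I}$ respectively, and let $\theta_1$ and $\theta_2$ be the frame transforms of $\{a_i\}_{i \in I}$ and $\{b_i\}_{i \in I}$ respectively. Then the following statements are equivalent: 1. $\{u_i \oplus v_i\}_{i \in I}$ is a $K_1 \oplus K_2$-frame for $\mathcal{H}_1 \oplus \mathcal{H}_2$ and $\{a_i \oplus b_i\}_{i \in I}$ is a $K_1 \oplus K_2$-dual frame to it. 2. $T_2 \theta_1 = 0$ on $\mathcal{H}_1$ and $T_1 \theta_2 = 0$ on $\mathcal{H}_2$.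
   Context: $\mathbb{H}$ denotes the skew field of quaternions. A right quaternionic Hilbert space is a right $\mathbb{H}$-vector space with an inner product $\langle\cdot,\cdot\rangle$ valued in $\mathbb{H}$ satisfying $\langle u,v\rangle=\overline{\langle v,u\rangle}$, $\langle u,u\rangle>0$ for $u\neq 0$, additivity in the second variable and $\langle u,vq\rangle=\langle u,v\rangle q$ for $q\in\mathbb{H}$, complete for the norm $\|u\|=\sqrt{\langle u,u\rangle}$. $\mathbb{B}(\mathcal{H})$ is the set of bounded right $\mathbb{H}$-linear operators on $\mathcal{H}$; $L^*$ is the adjoint of $L$. $I$ is a countable index set, and $\ell^2(\mathbb{H})=\{\{q_i\}_{i\in I}\subset\mathbb{H}:\sum_{i\in I}|q_i|^2<\infty\}$ with $\langle p,q\rangle=\sum_{i\in I}\overline{p_i}q_i$. The direct sum $\mathcal{H}_1\oplus\mathcal{H}_2$ carries the inner product $\langle u_1\oplus v_1,u_2\oplus v_2\rangle=\langle u_1,u_2\rangle+\langle v_1,v_2\rangle$ and is a right quaternionic Hilbert space. $K_1\oplus K_2$ is the operator $(K_1\oplus K_2)(u\oplus v)=K_1u\oplus K_2v$. A sequence $\{w_i\}_{i\in I}$ in $\mathcal{H}$ is a Bessel sequence if there is $B<\infty$ with $\sum_{i\in I}|\langle w_i,u\rangle|^2\le B\|u\|^2$ for all $u\in\mathcal{H}$. Its synthesis (pre-frame) operator is $T:\ell^2(\mathbb{H})\to\mathcal{H}$, $T(\{q_i\})=\sum_{i\in I}w_iq_i$, and its frame transform is $\theta=T^*:\mathcal{H}\to\ell^2(\mathbb{H})$,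 $\theta u=\{\langle w_i,u\rangle\}_{i\in I}$. For $K\in\mathbb{B}(\mathcal{H})$, $\{w_i\}_{i\in I}$ is a $K$-frame for $\mathcal{H}$ if there are $0<A\le B<\infty$ with $A\|K^*u\|^2\le\sum_{i\in I}|\langle w_i,u\rangle|^2\le B\|u\|^2$ for all $u\in\mathcal{H}$. A $K$-dual frame to a $K$-frame $\{w_i\}_{i\in I}$ is a Bessel sequence $\{z_i\}_{i\in I}$ for $\mathcal{H}$ such that $Ku=\sum_{i\in I}w_i\langle z_i,u\rangle$ for all $u\in\mathcal{H}$. *)

(* Defs.v *)
(* MathComp-Analysis; the real numbers are an arbitrary R : realType. *)
From HB Require Import structures.
From mathcomp Require Import all_boot all_order all_algebra finmap.
From mathcomp Require Import all_classical all_reals all_analysis.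
From mathcomp Require Import ring lra.
From mathcomp.analysis.showcase Require summability.

Set Implicit Arguments.
Unset Strict Implicit.
Unset Printing Implicit Defensive.

Import Order.TTheory GRing.Theory Num.Theory.
Import numFieldNormedType.Exports.
Local Open Scope classical_set_scope.
Local Open Scope ring_scope.

Lemma sqrt_sum_sq_triangle (R : rcfType) (a b c d : R) :
  Num.sqrt ((a + c) ^+ 2 + (b + d) ^+ 2) <=
  Num.sqrt (a ^+ 2 + b ^+ 2) + Num.sqrt (c ^+ 2 + d ^+ 2).
Proof.
have sq_ge0 (x y : R) : 0 <= x ^+ 2 + y ^+ 2 by rewrite addr_ge0 ?sqr_ge0.
rewrite -(ler_pXn2r (n := 2)) ?nnegrE ?addr_ge0 ?sqrtr_ge0 //.
rewrite (sqrrD (Num.sqrt _)) !sqr_sqrtr // !sqrrD.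
suff : a * c + b * d <= Num.sqrt (a ^+ 2 + b ^+ 2) * Num.sqrt (c ^+ 2 + d ^+ 2).
  set X := _ + _ => h; set Y := Num.sqrt _ * _ in h *.
  rewrite (_ : a ^+ 2 + (a * c) *+ 2 + c ^+ 2 + (b ^+ 2 + (b * d) *+ 2 + d ^+ 2) =
    a ^+ 2 + b ^+ 2 + X *+ 2 + (c ^+ 2 + d ^+ 2)); last by rewrite /X; ring.
  by rewrite lerD2r lerD2l lerMn2r h orbT.
rewrite -sqrtrM // (le_trans (ler_norm _)) // -sqrtr_sqr ler_wsqrtr //.
have := sqr_ge0 (a * d - b * c); rewrite -[X in _ -> is_true X]subr_ge0.
by congr (is_true (0 <= _)); ring.
Qed.

Lemma ler_sqrt_sum_sq (R : rcfType) (a b c d : R) :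
  0 <= a -> 0 <= b -> a <= c -> b <= d ->
  Num.sqrt (a ^+ 2 + b ^+ 2) <= Num.sqrt (c ^+ 2 + d ^+ 2).
Proof.
move=> a0 b0 ac bd; rewrite ler_wsqrtr// lerD// ler_pXn2r// nnegrE//.
  exact: le_trans ac.
exact: le_trans bd.
Qed.

(* Quaternions x + i y + j z + k t. *)
Record quat (R : realType) := Quat { qre : R; qimi : R; qimj : R; qimk : R }.

Section Quaternions.
Variable R : realType.
Implicit Types p q : quat R.

Definition prod_of_quat q := (qre q, qimi q, qimj q, qimk q).
Definition quat_of_prod (x : R * R * R * R) :=
  Quat x.1.1.1 x.1.1.2 x.1.2 x.2.
Lemma prod_of_quatK : cancel prod_of_quat quat_of_prod.
Proof. by case. Qed.

HB.instance Definition _ := Choice.copy (quat R) (can_type prod_of_quatK).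

Definition qzero := Quat (0 : R) 0 0 0.
Definition qone := Quat (1 : R) 0 0 0.
Definition qadd p q :=
  Quat (qre p + qre q) (qimi p + qimi q) (qimj p + qimj q) (qimk p + qimk q).
Definition qopp q := Quat (- qre q) (- qimi q) (- qimj q) (- qimk q).
Definition qmul p q :=
  let: Quat a b c d := p in let: Quat a' b' c' d' := q in
  Quat (a * a' - b * b' - c * c' - d * d')
       (a * b' + b * a' + c * d' - d * c')
       (a * c' - b * d' + c * a' + d * b')
       (a * d' + b * c' - c * b' + d * a').
Definition qconj q := Quat (qre q) (- qimi q) (- qimj q) (- qimk q).
Definition qabs q :=
  Num.sqrt (qre q ^+ 2 + qimi q ^+ 2 + qimj q ^+ 2 + qimk q ^+ 2).

Lemma qaddA : associative qadd.
Proof. by move=> p q r; congr Quat; rewrite /= addrA. Qed.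
Lemma qaddC : commutative qadd.
Proof. by move=> p q; congr Quat; rewrite /= addrC. Qed.
Lemma qadd0 : left_id qzero qadd.
Proof. by case=> a b c d; congr Quat; rewrite /= add0r. Qed.
Lemma qaddN : left_inverse qzero qopp qadd.
Proof. by case=> a b c d; congr Quat; rewrite /= addNr. Qed.

HB.instance Definition _ :=
  GRing.isZmodule.Build (quat R) qaddA qaddC qadd0 qaddN.

Lemma qmulA : associative qmul.
Proof. by case=> ? ? ? ? [? ? ? ?] [? ? ? ?]; congr Quat; rewrite /=; ring. Qed.
Lemma qmul1l : left_id qone qmul.
Proof. by case=> ? ? ? ?; congr Quat; rewrite /=; ring. Qed.
Lemma qmul1r : right_id qone qmul.
Proof. by case=> ? ? ? ?; congr Quat; rewrite /=; ring. Qed.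
Lemma qmulDl : left_distributive qmul qadd.
Proof. by case=> ? ? ? ? [? ? ? ?] [? ? ? ?]; congr Quat; rewrite /=; ring. Qed.
Lemma qmulDr : right_distributive qmul qadd.
Proof. by case=> ? ? ? ? [? ? ? ?] [? ? ? ?]; congr Quat; rewrite /=; ring. Qed.
Lemma qone_neq0 : qone != qzero.
Proof. by apply/eqP => -[] /eqP; rewrite oner_eq0. Qed.

HB.instance Definition _ := GRing.Zmodule_isNzRing.Build (quat R)
  qmulA qmul1l qmul1r qmulDl qmulDr qone_neq0.

Definition qinv q : quat R :=
  if q == 0 then 0 else
  let n := qabs q ^+ 2 in
  Quat (qre q / n) (- qimi q / n) (- qimj q / n) (- qimk q / n).

Let sum4_ge0 (a b c d : R) : 0 <= a ^+ 2 + b ^+ 2 + c ^+ 2 + d ^+ 2.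
Proof. by rewrite !addr_ge0 ?sqr_ge0. Qed.

Lemma qabs0_eq0 q : qabs q = 0 -> q = 0.
Proof.
case: q => a b c d; rewrite /qabs /= => /eqP; rewrite sqrtr_eq0 => h.
have : a ^+ 2 + b ^+ 2 + c ^+ 2 + d ^+ 2 == 0 by rewrite eq_le h sum4_ge0.
rewrite !paddr_eq0 ?addr_ge0 ?sqr_ge0// !sqrf_eq0.
by move=> /andP[/andP[/andP[/eqP-> /eqP->] /eqP->] /eqP->].
Qed.

Lemma qmulV : {in [pred q : quat R | q != 0], left_inverse 1 qinv *%R}.
Proof.
move=> q; rewrite inE => q0; rewrite /qinv (negPf q0).
have : qabs q != 0 by apply: contra_neq q0; exact: qabs0_eq0.
rewrite -sqrf_eq0 /qabs sqr_sqrtr //.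
by case: q {q0} => a b c d /= n0; congr Quat; field.
Qed.

Lemma qmulV' : {in [pred q : quat R | q != 0], right_inverse 1 qinv *%R}.
Proof.
move=> q; rewrite inE => q0; rewrite /qinv (negPf q0).
have : qabs q != 0 by apply: contra_neq q0; exact: qabs0_eq0.
rewrite -sqrf_eq0 /qabs sqr_sqrtr //.
by case: q {q0} => a b c d /= n0; congr Quat; field.
Qed.

Lemma qunitP p q : q * p = 1 /\ p * q = 1 -> p != 0.
Proof.
by case=> h _; apply/eqP => p0; have := oner_neq0 (quat R); rewrite -h p0 mulr0 eqxx.
Qed.

Lemma qinv_out : {in [predC [pred q : quat R | q != 0]], qinv =1 id}.
Proof. by move=> q; rewrite !inE negbK => /eqP ->; rewrite /qinv eqxx. Qed.

(* The units are by definition the nonzero elements: quat R is a skew field. *)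
HB.instance Definition _ := GRing.NzRing_hasMulInverse.Build (quat R)
  qmulV qmulV' qunitP qinv_out.

Lemma qabsD p q : qabs (p + q) <= qabs p + qabs q.
Proof.
have e (a b c d : R) : Num.sqrt (a ^+ 2 + b ^+ 2 + c ^+ 2 + d ^+ 2) =
    Num.sqrt (Num.sqrt (a ^+ 2 + b ^+ 2) ^+ 2 + Num.sqrt (c ^+ 2 + d ^+ 2) ^+ 2).
  by rewrite !sqr_sqrtr ?addr_ge0 ?sqr_ge0// !addrA.
rewrite /qabs !e; apply: le_trans (sqrt_sum_sq_triangle _ _ _ _).
by apply: ler_sqrt_sum_sq; rewrite ?sqrtr_ge0 ?sqrt_sum_sq_triangle.
Qed.

Lemma qabsMn q n : qabs (q *+ n) = qabs q *+ n.
Proof.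
have -> : q *+ n = Quat (qre q *+ n) (qimi q *+ n) (qimj q *+ n) (qimk q *+ n).
  elim: n => [//|n IH]; rewrite mulrS IH.
  by congr Quat; rewrite /= -mulrS.
rewrite /qabs /= !exprMn_n -!mulrnDl -[X in Num.sqrt X]mulr_natr sqrtrM ?sum4_ge0//.
by rewrite natrX sqrtr_sqr ger0_norm// mulr_natr.
Qed.

Lemma qabsN q : qabs (- q) = qabs q.
Proof. by rewrite /qabs /= !sqrrN. Qed.

HB.instance Definition _ :=
  Num.Zmodule_isNormed.Build R (quat R) qabsD qabs0_eq0 qabsMn qabsN.

End Quaternions.

(* rscale v q is the right multiple v q. The real scaling of the underlying
   normed space is the restriction of the right action to real quaternions, and
   the norm, hence the topology, is that of the inner product. As qinner u u is
   equal to its conjugate, it is real, and its positivity is that of its real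
   part. *)
HB.mixin Record isQuatHilbert (R : realType) V & CompleteNormedModule R V := {
  rscale : V -> quat R -> V;
  rscaleA : forall v p q, rscale (rscale v p) q = rscale v (p * q);
  rscale1 : forall v, rscale v 1 = v;
  rscaleDl : forall u v q, rscale (u + v) q = rscale u q + rscale v q;
  rscaleDr : forall v p q, rscale v (p + q) = rscale v p + rscale v q;
  rscale_real : forall (v : V) (r : R), rscale v (Quat r 0 0 0) = r *: v;
  qinner : V -> V -> quat R;
  qinnerC : forall u v, qinner u v = qconj (qinner v u);
  qinner_gt0 : forall u, u != 0 -> 0 < qre (qinner u u);
  qinnerDr : forall u v w, qinner u (v + w) = qinner u v + qinner u w;
  qinnerZr : forall u v q, qinner u (rscale v q) = qinner u v * q;
  qnormE : forall u : V, `|u| = Num.sqrt (qre (qinner u u))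
}.

#[short(type="quatHilbertType")]
HB.structure Definition QuatHilbert (R : realType) :=
  {V of CompleteNormedModule R V & isQuatHilbert R V}.

Notation "v :*: q" := (rscale v q) (at level 40, left associativity) : ring_scope.
Notation "⟨ u , v ⟩" := (qinner u v) (at level 0, format "⟨ u ,  v ⟩") : ring_scope.

Lemma qinner_self_real (R : realType) (V : quatHilbertType R) (u : V) :
  ⟨u, u⟩ = Quat (qre ⟨u, u⟩) 0 0 0.
Proof.
have := qinnerC u u; case: (⟨u, u⟩) => a b c d [] /=.
by move=> hb hc hd; congr Quat; lra.
Qed.

(* The bounded right quat-linear operators. *)
Record boundedOp (R : realType) (V W : quatHilbertType R) := BoundedOp {
  bop :> V -> W;
  bopD : forall u v, bop (u + v) = bop u + bop v;
  bopZ : forall v q, bop (v :*: q) = bop v :*: q;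
  bop_bounded : exists M : R, forall v, `|bop v| <= M * `|v| }.

(* The adjoint exists, and is unique, by the Riesz representation theorem. *)
Definition adjoint (R : realType) (V W : quatHilbertType R) (K : boundedOp V W)
    (w : W) : V :=
  get [set v : V | forall u, ⟨K u, w⟩ = ⟨u, v⟩].

Section DirectSum.
Context (R : realType) (V W : quatHilbertType R).

(* An alias of the product type, which already carries the maximum norm. *)
Definition dsum : Type := (V * W)%type.

Definition dsum_pair (v : V) (w : W) : dsum := (v, w).

HB.instance Definition _ := GRing.Lmodule.copy dsum (V * W)%type.

Definition dsum_norm (x : dsum) : R := Num.sqrt (`|x.1| ^+ 2 + `|x.2| ^+ 2).

Lemma dsum_normD x y : dsum_norm (x + y) <= dsum_norm x + dsum_norm y.
Proof.
apply: le_trans (sqrt_sum_sq_triangle _ _ _ _).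
by apply: ler_sqrt_sum_sq; rewrite ?normr_ge0 ?ler_normD.
Qed.

Lemma dsum_normZ (r : R) (x : dsum) : dsum_norm (r *: x) = `|r| * dsum_norm x.
Proof.
rewrite /dsum_norm !normrZ !exprMn -mulrDr sqrtrM ?sqr_ge0//.
by rewrite sqrtr_sqr normr_id.
Qed.

Lemma dsum_norm0_eq0 x : dsum_norm x = 0 -> x = 0.
Proof.
case: x => v w /eqP; rewrite sqrtr_eq0 => h.
have : `|v| ^+ 2 + `|w| ^+ 2 == 0 by rewrite eq_le h addr_ge0 ?sqr_ge0.
by rewrite paddr_eq0 ?sqr_ge0// !sqrf_eq0 !normr_eq0 => /andP[/eqP-> /eqP->].
Qed.

HB.instance Definition _ :=
  Lmodule_isNormed.Build R dsum dsum_normD dsum_normZ dsum_norm0_eq0.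

Lemma dsum_norm_fst (x : dsum) : `|x.1| <= `|x|.
Proof.
rewrite -[leLHS]normr_id -sqrtr_sqr ler_wsqrtr// lerDl sqr_ge0//.
Qed.

Lemma dsum_norm_snd (x : dsum) : `|x.2| <= `|x|.
Proof.
rewrite -[leLHS]normr_id -sqrtr_sqr ler_wsqrtr// lerDr sqr_ge0//.
Qed.

Lemma dsum_norm_le (x : dsum) : `|x| <= `|x.1| + `|x.2|.
Proof.
have := sqrt_sum_sq_triangle `|x.1| 0 0 `|x.2|.
by rewrite addr0 add0r expr0n addr0 add0r !sqrtr_sqr !normr_id.
Qed.

Lemma dsum_complete (F : set_system dsum) : ProperFilter F -> cauchy F -> cvg F.
Proof.
move=> FF /cauchyP Fc.
have /cauchy_cvg/cvg_ex[v Fv] : cauchy ((fst : dsum -> V) @ F).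
  apply/cauchyP => e e0; have [x Fx] := Fc e e0.
  exists (fst x); apply: (@filterS _ F _ _ _ _ Fx) => y; rewrite -!ball_normE /=.
  by apply: le_lt_trans; exact: (dsum_norm_fst (x - y)).
have /cauchy_cvg/cvg_ex[w Fw] : cauchy ((snd : dsum -> W) @ F).
  apply/cauchyP => e e0; have [x Fx] := Fc e e0.
  exists (snd x); apply: (@filterS _ F _ _ _ _ Fx) => y; rewrite -!ball_normE /=.
  by apply: le_lt_trans; exact: (dsum_norm_snd (x - y)).
apply/cvg_ex; exists (dsum_pair v w); apply/cvgrPdist_lt => e e0.
have e2 : 0 < e / 2 by rewrite divr_gt0.
near=> x; apply: le_lt_trans (dsum_norm_le _) _; rewrite (splitr e) ltrD//=.
  by near: x; move/cvgrPdist_lt : Fv; apply.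
by near: x; move/cvgrPdist_lt : Fw; apply.
Unshelve. all: by end_near. Qed.

HB.instance Definition _ := Uniform_isComplete.Build dsum dsum_complete.

Definition dsum_rscale (x : dsum) (q : quat R) : dsum := (x.1 :*: q, x.2 :*: q).
Definition dsum_inner (x y : dsum) : quat R := ⟨x.1, y.1⟩ + ⟨x.2, y.2⟩.

Lemma dsum_rscaleA v p q :
  dsum_rscale (dsum_rscale v p) q = dsum_rscale v (p * q).
Proof. by rewrite /dsum_rscale /= !rscaleA. Qed.
Lemma dsum_rscale1 v : dsum_rscale v 1 = v.
Proof. by case: v => v w; rewrite /dsum_rscale /= !rscale1. Qed.
Lemma dsum_rscaleDl u v q :
  dsum_rscale (u + v) q = dsum_rscale u q + dsum_rscale v q.
Proof. by rewrite /dsum_rscale /= !rscaleDl. Qed.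
Lemma dsum_rscaleDr v p q :
  dsum_rscale v (p + q) = dsum_rscale v p + dsum_rscale v q.
Proof. by rewrite /dsum_rscale /= !rscaleDr. Qed.
Lemma dsum_rscale_real (v : dsum) (r : R) :
  dsum_rscale v (Quat r 0 0 0) = r *: v.
Proof. by rewrite /dsum_rscale /= !rscale_real. Qed.
Lemma dsum_innerC u v : dsum_inner u v = qconj (dsum_inner v u).
Proof.
rewrite /dsum_inner (qinnerC u.1) (qinnerC u.2).
by congr Quat; rewrite /= opprD.
Qed.
Lemma dsum_innerDr u v w :
  dsum_inner u (v + w) = dsum_inner u v + dsum_inner u w.
Proof. by rewrite /dsum_inner /= !qinnerDr addrACA. Qed.
Lemma dsum_innerZr u v q :
  dsum_inner u (dsum_rscale v q) = dsum_inner u v * q.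
Proof. by rewrite /dsum_inner /= !qinnerZr mulrDl. Qed.
Lemma dsum_normE (u : dsum) : `|u| = Num.sqrt (qre (dsum_inner u u)).
Proof.
have e (H : quatHilbertType R) (v : H) : `|v| ^+ 2 = qre ⟨v, v⟩.
  rewrite qnormE sqr_sqrtr//; have [->|/qinner_gt0/ltW//] := eqVneq v 0.
  have := qinnerDr (0 : H) 0 0; rewrite addr0 => /eqP.
  by rewrite -subr_eq subrr => /eqP <-.
by congr Num.sqrt; rewrite /= !e.
Qed.
Lemma dsum_inner_gt0 (u : dsum) : u != 0 -> 0 < qre (dsum_inner u u).
Proof. by rewrite -normr_gt0 dsum_normE sqrtr_gt0. Qed.

HB.instance Definition _ := isQuatHilbert.Build R dsum
  dsum_rscaleA dsum_rscale1 dsum_rscaleDl dsum_rscaleDr dsum_rscale_real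
  dsum_innerC dsum_inner_gt0 dsum_innerDr dsum_innerZr dsum_normE.

End DirectSum.

Section OperatorSum.
Context (R : realType) (V W : quatHilbertType R).
Variables (K : boundedOp V V) (L : boundedOp W W).

Definition opsum_fun (x : dsum V W) : dsum V W := dsum_pair (K x.1) (L x.2).

Lemma opsumD x y : opsum_fun (x + y) = opsum_fun x + opsum_fun y.
Proof. by rewrite /opsum_fun /= !bopD. Qed.

Lemma opsumZ x q : opsum_fun (x :*: q) = opsum_fun x :*: q.
Proof. by rewrite /opsum_fun /= !bopZ. Qed.

Lemma opsum_bounded : exists M : R, forall x, `|opsum_fun x| <= M * `|x|.
Proof.
have [M hM] := bop_bounded K; have [N hN] := bop_bounded L.
exists (`|M| + `|N|) => x; apply: le_trans (dsum_norm_le _) _ => /=.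
rewrite mulrDl lerD//.
  apply: le_trans (hM _) _; apply: le_trans (ler_norm _) _.
  by rewrite normrM normr_id ler_wpM2l// dsum_norm_fst.
apply: le_trans (hN _) _; apply: le_trans (ler_norm _) _.
by rewrite normrM normr_id ler_wpM2l// dsum_norm_snd.
Qed.

Definition opsum : boundedOp (dsum V W) (dsum V W) :=
  BoundedOp opsumD opsumZ opsum_bounded.

End OperatorSum.

(* Square-summable quaternionic families, i.e. the elements of l^2(quat). *)
Record ell2 (R : realType) (I : countType) := Ell2 {
  ell2_seq :> I -> quat R;
  ell2_summable : (\esum_(i in [set: I]) (`|ell2_seq i| ^+ 2)%:E < +oo)%E }.

Section Frames.
Context (R : realType) (I : countType) (V : quatHilbertType R).
Implicit Types (K : boundedOp V V) (w z : I -> V).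

(* Convergence of a vector series is that of the net of its finite partial sums,
   hence independent of any enumeration of I. *)
Definition series_cvg (x : I -> V) (s : V) :=
  summability.partial_sum x @ summability.totally --> s.

Definition bessel w := exists B : R, forall u : V,
  (\esum_(i in [set: I]) (`|⟨w i, u⟩| ^+ 2)%:E <= (B * `|u| ^+ 2)%:E)%E.

(* The series converges for every q when w is a Bessel sequence. *)
Definition synthesis w (q : ell2 R I) : V :=
  summability.sum (fun i => w i :*: q i).

Lemma bessel_ell2 w : bessel w -> forall u : V,
  (\esum_(i in [set: I]) (`|⟨w i, u⟩| ^+ 2)%:E < +oo)%E.
Proof. by case=> B hB u; apply: le_lt_trans (hB u) (ltry _). Qed.

Definition frame_transform w (hw : bessel w) (u : V) : ell2 R I :=
  Ell2 (bessel_ell2 hw u).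

Definition Kframe K w := exists A B : R,
  [/\ 0 < A, A <= B & forall u : V,
    ((A * `|adjoint K u| ^+ 2)%:E <=
       \esum_(i in [set: I]) (`|⟨w i, u⟩| ^+ 2)%:E)%E /\
    (\esum_(i in [set: I]) (`|⟨w i, u⟩| ^+ 2)%:E <= (B * `|u| ^+ 2)%:E)%E].

(* z is a K-dual frame to w, for w a K-frame. *)
Definition Kdual K w z :=
  bessel z /\ forall u : V, series_cvg (fun i => w i :*: ⟨z i, u⟩) (K u).

Lemma bessel_Kdual K w z : Kdual K w z -> bessel z.
Proof. by case. Qed.

End Frames.

(* Main.v *)
Require Import Defs.
From mathcomp Require Import all_boot all_order all_algebra finmap.
From mathcomp Require Import all_classical all_reals all_analysis.
From mathcomp Require Import ring lra.
From mathcomp.analysis.showcase Require summability.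

Import Order.TTheory GRing.Theory Num.Theory.
Import numFieldNormedType.Exports.
Local Open Scope classical_set_scope.
Local Open Scope ring_scope.

(** The coefficient of [x + y] in [H1 + H2] against [a_i + b_i] is
    [<a_i, x> + <b_i, y>].  So the expansion of [x + y] in the direct sum has
    first component [\sum u_i <a_i, x> + \sum u_i <b_i, y>], that is
    [K1 x + T1 (theta2 y)], and second component [T2 (theta1 x) + K2 y]
    (dsum_coef, series_cvg_dsum).  Duality therefore holds exactly
    when both cross terms vanish; for the direct implication it suffices to
    test on [x + 0] and on [0 + y].

    The converse needs two more facts.  The operators [T1] and [T2] are defined
    as limits, so a value [0] says something about a series only once the series
    is known to converge; convergence of [\sum w_i q_i] for a Bessel family [w]
    and a square-summable [q] is synthesis_cvg, which rests on the estimate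
    [|\sum_J w_i q_i|^2 <= B \sum_J |q_i|^2] for finite [J]
    (synthesis_fset_le).  And the family [u_i + v_i] must be shown to be a frame:
    the upper bound is elementary (bessel_dsum), and the lower bound is a
    consequence of duality (Kdual_Kframe), because the adjoint of [K] is
    [x |-> \sum z_i <w_i, x>] when [z] is a [K]-dual of [w], to which the same
    estimate applies. *)

#[local] Existing Instance summability.totally_filter.

(** * Quaternions and the inner product *)

Lemma qabsE {R : realType} (q : quat R) :
  `|q| ^+ 2 = qre q ^+ 2 + qimi q ^+ 2 + qimj q ^+ 2 + qimk q ^+ 2.
Proof. by rewrite [ `|q| ]/(qabs q) /qabs sqr_sqrtr// !addr_ge0 ?sqr_ge0. Qed.

Lemma qabsM {R : realType} (p q : quat R) : `|p * q| = `|p| * `|q|.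
Proof.
apply/eqP; rewrite -(eqrXn2 (n := 2)) ?mulr_ge0//; apply/eqP.
rewrite exprMn !qabsE.
by case: p q => a b c d [a' b' c' d'] /=; ring.
Qed.

Lemma qabs_conj {R : realType} (q : quat R) : `|qconj q| = `|q|.
Proof.
apply/eqP; rewrite -(eqrXn2 (n := 2)) //; apply/eqP.
by rewrite !qabsE /= !sqrrN.
Qed.

Lemma qre_conjM_C {R : realType} (p q : quat R) :
  qre (qconj p * q) = qre (qconj q * p).
Proof. by case: p q => a b c d [a' b' c' d'] /=; ring. Qed.

(** Testing against [1], [i], [j] and [k] reads off the four components. *)
Lemma qre_conjM_inj {R : realType} (p q : quat R) :
  (forall r, qre (qconj r * p) = qre (qconj r * q)) -> p = q.
Proof.
case: p q => a b c d [a' b' c' d'] h.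
have := h (Quat 1 0 0 0); have := h (Quat 0 1 0 0).
have := h (Quat 0 0 1 0); have := h (Quat 0 0 0 1) => /=.
by move=> hd hc hb ha; congr Quat; lra.
Qed.

Lemma qre_le_abs {R : realType} (q : quat R) : qre q <= `|q|.
Proof.
apply: le_trans (ler_norm _) _; rewrite -(ler_pXn2r (n := 2)) ?nnegrE//.
by rewrite qabsE -normrX ger0_norm ?sqr_ge0// -!addrA lerDl !addr_ge0 ?sqr_ge0.
Qed.

Lemma qreD {R : realType} (p q : quat R) : qre (p + q) = qre p + qre q.
Proof. by []. Qed.

Lemma qre_sum {R : realType} (I : Type) (r : seq I) (f : I -> quat R) :
  qre (\sum_(i <- r) f i) = \sum_(i <- r) qre (f i).
Proof. exact: (big_morph (@qre R) (@qreD R)). Qed.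

Section Inner.
Context {R : realType} {V : quatHilbertType R}.
Implicit Types u v : V.

Lemma qinnerr0 u : ⟨u, 0⟩ = 0.
Proof. by apply: (addrI ⟨u, 0⟩); rewrite -qinnerDr !addr0. Qed.

Lemma qinnerDl u v (w : V) : ⟨u + v, w⟩ = ⟨u, w⟩ + ⟨v, w⟩.
Proof.
by rewrite qinnerC qinnerDr (qinnerC u) (qinnerC v); congr Quat; rewrite /= opprD.
Qed.

Lemma qinnerZl u v q : ⟨u :*: q, v⟩ = qconj q * ⟨u, v⟩.
Proof.
rewrite qinnerC qinnerZr (qinnerC u v); case: q ⟨v, u⟩ => a b c d [a' b' c' d'].
by congr Quat => /=; ring.
Qed.

Lemma qinnerBr u v (w : V) : ⟨u, v - w⟩ = ⟨u, v⟩ - ⟨u, w⟩.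
Proof. by apply/eqP; rewrite eq_sym subr_eq -qinnerDr subrK. Qed.

Lemma qinnerNr u v : ⟨u, - v⟩ = - ⟨u, v⟩.
Proof. by rewrite -[- v]add0r qinnerBr qinnerr0 sub0r. Qed.

Lemma qinner_sumr (I : Type) (r : seq I) u (f : I -> V) :
  ⟨u, \sum_(i <- r) f i⟩ = \sum_(i <- r) ⟨u, f i⟩.
Proof. exact: (big_morph (qinner u) (qinnerDr u) (qinnerr0 u)). Qed.

Lemma abs_qinnerC u v : `|⟨u, v⟩| = `|⟨v, u⟩|.
Proof. by rewrite qinnerC qabs_conj. Qed.

Lemma qre_qinnerC u v : qre ⟨u, v⟩ = qre ⟨v, u⟩.
Proof. by rewrite qinnerC. Qed.

Lemma sqr_norm_qinner u : `|u| ^+ 2 = qre ⟨u, u⟩.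
Proof.
rewrite qnormE sqr_sqrtr//; have [->|/qinner_gt0/ltW//] := eqVneq u 0.
by rewrite qinnerr0.
Qed.

(** Real parts suffice because the real part of the inner product is already
    definite. *)
Lemma qre_qinner_inj v (w : V) :
  (forall u, qre ⟨u, v⟩ = qre ⟨u, w⟩) -> v = w.
Proof.
move=> h; apply/eqP; rewrite -subr_eq0 -normr_eq0 -sqrf_eq0 sqr_norm_qinner.
by rewrite qinnerBr /= h subrr.
Qed.

Lemma qre_polarization u v :
  qre ⟨u, v⟩ = (`|u + v| ^+ 2 - `|u - v| ^+ 2) / 4.
Proof.
rewrite !sqr_norm_qinner qinnerDr qinnerBr !qinnerDl /=.
rewrite (qre_qinnerC (- v) u) (qre_qinnerC (- v) v) !qinnerNr /=.
by rewrite (qre_qinnerC v u); field.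
Qed.

(** By polarization, continuity reduces to that of the norm. *)
Lemma cvg_qre_qinner (T : Type) (F : set_system T) {FF : Filter F}
    (f : T -> V) s v :
  f @ F --> s -> (fun t => qre ⟨f t, v⟩) @ F --> qre ⟨s, v⟩.
Proof.
move=> fs; rewrite qre_polarization.
under eq_fun do rewrite qre_polarization.
apply: cvgM; last exact: cvg_cst.
by apply: cvgB; (under eq_fun do rewrite expr2); rewrite expr2;
  apply: cvgM; apply: cvg_norm;
  [apply: cvgD|apply: cvgD|apply: cvgB|apply: cvgB] => //; exact: cvg_cst.
Qed.

End Inner.

(** * Series and the synthesis operator *)

Section Finite.
Context {R : realType} {I : countType}.

Lemma sum_fsetD_sub (M : nmodType) (f : I -> M) (J J' : {fset I}) :
  (J `<=` J')%fset ->
  \sum_(i <- J') f i = \sum_(i <- J) f i + \sum_(i <- (J' `\` J)%fset) f i.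
Proof.
move=> JJ'; rewrite (big_fsetID _ (mem J) J') /=; congr (_ + _).
  apply: eq_fbigl => i; rewrite !inE /=; apply/andP/idP => [[]//|iJ].
  by split=> //; exact: (fsubsetP JJ').
by apply: eq_fbigl => i; rewrite !inE /= andbC.
Qed.

Lemma esum_leP (f : I -> R) (c : R) : (forall i, 0 <= f i) ->
  (\esum_(i in [set: I]) (f i)%:E <= c%:E)%E <->
  (forall J : {fset I}, \sum_(i <- J) f i <= c).
Proof.
move=> f0; split => [h J|h].
  rewrite -lee_fin; apply: le_trans h; apply: esum_ge; exists [set` J] => //.
  by rewrite fsbig_finite//= set_fsetK sumEFin.
apply: ge_ereal_sup => _ /= [X [finX _]] <-.
by rewrite fsbig_finite//= sumEFin lee_fin.
Qed.

End Finite.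

Section Linear.
Context {R : realType} {V : quatHilbertType R}.

Lemma rscale0 (v : V) : v :*: 0 = 0.
Proof. by apply: (addrI (v :*: 0)); rewrite -rscaleDr !addr0. Qed.

Lemma bop0 (K : boundedOp V V) : K 0 = 0.
Proof. by apply: (addrI (K 0)); rewrite -bopD !addr0. Qed.

End Linear.

Section Series.
Context {R : realType} {I : countType} {V : quatHilbertType R}.
Implicit Types (x y : I -> V) (w z : I -> V) (q : I -> quat R).

Lemma partial_sumE x (J : {fset I}) :
  summability.partial_sum x J = \sum_(i <- J) x i.
Proof. by rewrite /summability.partial_sum big_seq_fsetE. Qed.

Lemma series_cvg_sum x s : series_cvg x s -> summability.sum x = s.
Proof. by move=> xs; apply: cvg_lim xs; exact: norm_hausdorff. Qed.

Lemma series_cvgD x y s t : series_cvg x s -> series_cvg y t ->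
  series_cvg (fun i => x i + y i) (s + t).
Proof.
move=> xs yt; rewrite /series_cvg.
have -> : summability.partial_sum (fun i => x i + y i) =
    (fun J => summability.partial_sum x J + summability.partial_sum y J).
  by apply/funext => J; rewrite !partial_sumE big_split.
exact: cvgD.
Qed.

(** The Bessel inequality on finite subfamilies, where it is an inequality
    between real numbers. *)
Definition bessel_le w (B : R) := forall (u : V) (J : {fset I}),
  \sum_(i <- J) `|⟨w i, u⟩| ^+ 2 <= B * `|u| ^+ 2.

(** Positivity lets [B] weigh, and divide, the estimates below; a Bessel bound
    itself may be zero, or even negative on the zero space. *)
Lemma bessel_bound w : bessel w -> exists2 B : R, 0 < B & bessel_le w B.
Proof.
case=> B hB; exists (`|B| + 1) => [|u]; first by rewrite ltr_wpDl.
apply/esum_leP => [i|]; first exact: sqr_ge0.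
apply: le_trans (hB u) _; rewrite lee_fin ler_wpM2r ?sqr_ge0//.
by rewrite (le_trans (ler_norm B))// lerDl.
Qed.

(** The squared norm of the synthesis operator is at most any Bessel bound, as
    for its adjoint.  For the finite sum [s] one has
    [|s|^2 <= \sum |<w_i, s>| |q_i|]; the inequality of arithmetic and geometric
    means, weighted by [B], bounds this through the Bessel inequality at [s] by
    half of [|s|^2] plus half of [B \sum |q_i|^2]. *)
Lemma synthesis_fset_le w (B : R) : 0 < B -> bessel_le w B ->
  forall q (J : {fset I}),
    `|\sum_(i <- J) w i :*: q i| ^+ 2 <= B * \sum_(i <- J) `|q i| ^+ 2.
Proof.
move=> B0 hB q J; set s := \sum_(i <- J) _.
have hs : 2 * B * `|s| ^+ 2 <=
    \sum_(i <- J) `|⟨w i, s⟩| ^+ 2 + B ^+ 2 * \sum_(i <- J) `|q i| ^+ 2.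
  rewrite sqr_norm_qinner {2}/s qinner_sumr qre_sum !mulr_sumr -big_split /=.
  apply: ler_sum => i _; rewrite qinnerZr.
  have h : qre (⟨s, w i⟩ * q i) <= `|⟨w i, s⟩| * `|q i|.
    by apply: le_trans (qre_le_abs _) _; rewrite qabsM abs_qinnerC.
  have := sqr_ge0 (`|⟨w i, s⟩| - B * `|q i|).
  have : 2 * B * qre (⟨s, w i⟩ * q i) <= 2 * B * (`|⟨w i, s⟩| * `|q i|).
    by rewrite ler_pM2l// mulr_gt0.
  move: (qre _) `|⟨w i, s⟩| `|q i| => t x y; nra.
by rewrite -(ler_pM2l B0); move: hs (hB s J); lra.
Qed.

(** The estimate on finite sums makes the partial sums Cauchy, since the sums of
    [|q_i|^2] outside a large finite set are small; it passes to the limit. *)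
Lemma synthesis_cvg w (B : R) q (c : R) : 0 < B -> bessel_le w B ->
  (\esum_(i in [set: I]) (`|q i| ^+ 2)%:E <= c%:E)%E ->
  exists2 s, series_cvg (fun i => w i :*: q i) s & `|s| ^+ 2 <= B * c.
Proof.
move=> B0 hB /(esum_leP _ _ (fun i => sqr_ge0 _)) hc.
pose S (J : {fset I}) := \sum_(i <- J) `|q i| ^+ 2.
pose P := summability.partial_sum (fun i => w i :*: q i).
have PJ (J : {fset I}) : `|P J| ^+ 2 <= B * S J.
  by rewrite /P partial_sumE; exact: synthesis_fset_le.
have /cauchy_cvg/cvg_ex[s Ps] : cauchy (P @ summability.totally).
  apply/cauchyP => e e0.
  have d0 : 0 < e ^+ 2 / B by rewrite divr_gt0// exprn_gt0.
  have hS : has_sup (range S).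
    by split; [exists (S fset0), fset0|exists c => _ [J _ <-]; exact: hc].
  (* Beyond J the squares of the q_i sum to less than e^2 / B. *)
  have [_ [J _ <-] SJ] := sup_adherent d0 hS.
  exists (P J); exists J => // J' /= JJ'.
  rewrite -ball_normE /= -(ltr_pXn2r (n := 2)) ?nnegrE// ?ltW//.
  have -> : P J - P J' = - \sum_(i <- (J' `\` J)%fset) w i :*: q i.
    rewrite /P !partial_sumE (sum_fsetD_sub _ _ J J' JJ').
    by rewrite opprD addrA subrr sub0r.
  rewrite normrN; apply: le_lt_trans (synthesis_fset_le w B B0 hB q _) _.
  rewrite -ltr_pdivlMl// mulrC.
  have : S J' <= sup (range S) by apply: ub_le_sup; [case: hS|exists J'].
  rewrite /S (sum_fsetD_sub _ _ J J' JJ') -/(S J).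
  by move: SJ; lra.
exists s => //.
have Ps2 : (fun J => `|P J| ^+ 2) @ summability.totally --> `|s| ^+ 2.
  by (under eq_fun do rewrite expr2); rewrite expr2; apply: cvgM; exact: cvg_norm.
refine (closed_cvg (fun r : R => r <= B * c) (@closed_le _ _) _ _ Ps2).
by apply: nearW => J; rewrite (le_trans (PJ J))// ler_pM2l//; exact: hc.
Qed.

Lemma synthesis_series_cvg w (q : ell2 R I) :
  bessel w -> series_cvg (fun i => w i :*: q i) (synthesis w q).
Proof.
move=> /bessel_bound[B B0 hB].
have [|s ws _] := synthesis_cvg w B q
  (fine (\esum_(i in [set: I]) (`|q i| ^+ 2)%:E)%E) B0 hB.
  rewrite fineK// ge0_fin_numE ?ell2_summable//.
  by apply: esum_ge0 => i _; rewrite lee_fin sqr_ge0.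
by rewrite /synthesis (series_cvg_sum _ _ ws).
Qed.

Lemma Kframe_bessel (K : boundedOp V V) w : Kframe K w -> bessel w.
Proof. by case=> A [B [_ _ h]]; exists B => x; case: (h x). Qed.

End Series.

(** * Duality and frames *)

Section Duality.
Context {R : realType} {I : countType} {V : quatHilbertType R}.
Implicit Types w z : I -> V.

Lemma adjoint_unique (K : boundedOp V V) (x s : V) :
  (forall u, ⟨K u, x⟩ = ⟨u, s⟩) -> adjoint K x = s.
Proof.
move=> h; apply: qre_qinner_inj => u.
have := @getPex _ [set v : V | forall u, ⟨K u, x⟩ = ⟨u, v⟩].
by move=> /(_ (ex_intro _ s h)) /(_ u); rewrite -/(adjoint K x) h => ->.
Qed.

(** The real part of the adjoint relation already is the whole relation:
    replacing [u] by its multiples [u q] recovers the other three components. *)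
Lemma adjoint_unique_re (K : boundedOp V V) (x s : V) :
  (forall u, qre ⟨K u, x⟩ = qre ⟨u, s⟩) -> adjoint K x = s.
Proof.
move=> h; apply: adjoint_unique => u; apply: qre_conjM_inj => q.
by rewrite -!qinnerZl -bopZ.
Qed.

(** Transposing each term of [K u = \sum w_i <z_i, u>] exchanges the roles of
    [w] and [z]. *)
Lemma Kdual_adjoint_cvg (K : boundedOp V V) w z (x s : V) :
  Kdual K w z ->
  series_cvg (fun i => z i :*: ⟨w i, x⟩) s -> adjoint K x = s.
Proof.
case=> _ hK zs; apply: adjoint_unique_re => u.
have h1 := cvg_qre_qinner _ _ _ _ x (hK u).
have h2 := cvg_qre_qinner _ _ _ _ u zs.
rewrite [RHS]qre_qinnerC -(cvg_lim (@Rhausdorff R) (h2 _)).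
rewrite -(cvg_lim (@Rhausdorff R) (h1 _)); congr (lim (_ @ summability.totally)).
apply/funext => J; rewrite qre_qinnerC [RHS]qre_qinnerC !partial_sumE.
rewrite !qinner_sumr !qre_sum; apply: eq_bigr => i _; rewrite !qinnerZr.
by rewrite (qinnerC x) (qinnerC u) qre_conjM_C.
Qed.

(** As [K^* x = \sum z_i <w_i, x>] is a synthesis of the coefficients
    [<w_i, x>] by the Bessel family [z], the synthesis bound is the lower
    frame inequality, with [A] the inverse of a Bessel bound of [z].  The
    existence of [K^* x] comes from the convergence of this series. *)
Lemma Kdual_Kframe (K : boundedOp V V) w z :
  bessel w -> Kdual K w z -> Kframe K w.
Proof.
move=> bw hK; have [Bw Bw0 hw] := bessel_bound w bw.
have [Bz Bz0 hz] := bessel_bound z hK.1.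
(* The summand 1 / Bz only serves to make the upper bound exceed the lower. *)
exists Bz^-1, (Bw + Bz^-1); split=> [||x]; first by rewrite invr_gt0.
  by rewrite lerDr ltW.
have hx : (\esum_(i in [set: I]) (`|⟨w i, x⟩| ^+ 2)%:E <= (Bw * `|x| ^+ 2)%:E)%E.
  by apply/esum_leP => // i; exact: sqr_ge0.
split; last first.
  apply: le_trans hx _; rewrite lee_fin ler_wpM2r ?sqr_ge0//.
  by rewrite lerDl invr_ge0 ltW.
have e0 : (0 <= \esum_(i in [set: I]) (`|⟨w i, x⟩| ^+ 2)%:E)%E.
  by apply: esum_ge0 => i _; rewrite lee_fin sqr_ge0.
have hfin : (\esum_(i in [set: I]) (`|⟨w i, x⟩| ^+ 2)%:E)%E \is a fin_num.
  by rewrite ge0_fin_numE// (le_lt_trans hx)// ltry.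
have [|s zs sB] := synthesis_cvg z Bz (fun i => ⟨w i, x⟩)
  (fine (\esum_(i in [set: I]) (`|⟨w i, x⟩| ^+ 2)%:E)%E) Bz0 hz.
  by rewrite fineK.
rewrite (Kdual_adjoint_cvg K w z x s hK zs) -(fineK hfin) lee_fin.
by rewrite ler_pdivrMl.
Qed.

End Duality.

(** * Direct sums *)

Section DirectSum.
Context {R : realType} {I : countType} {H1 H2 : quatHilbertType R}.
Implicit Types (u a : I -> H1) (v b : I -> H2).

Lemma series_cvg_dsum (x : I -> H1) (y : I -> H2) s t :
  series_cvg (fun i => dsum_pair (x i) (y i)) (dsum_pair s t) <->
  series_cvg x s /\ series_cvg y t.
Proof.
have E (J : {fset I}) :
    summability.partial_sum (fun i => dsum_pair (x i) (y i)) J =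
    dsum_pair (summability.partial_sum x J) (summability.partial_sum y J).
  rewrite !partial_sumE.
  by elim/big_rec3: _ => [//|i p q r _ ->].
split=> [h|[xs yt]].
  split; apply/cvgrPdist_lt => e e0.
    move/cvgrPdist_lt : h => /(_ e e0); apply: filterS => J; rewrite E.
    by apply: le_lt_trans; exact: (dsum_norm_fst (dsum_pair s t - dsum_pair _ _)).
  move/cvgrPdist_lt : h => /(_ e e0); apply: filterS => J; rewrite E.
  by apply: le_lt_trans; exact: (dsum_norm_snd (dsum_pair s t - dsum_pair _ _)).
apply/cvgrPdist_lt => e e0.
have e2 : 0 < e / 2 by rewrite divr_gt0.
near=> J; rewrite E; apply: le_lt_trans (dsum_norm_le _) _.
rewrite (splitr e) ltrD//=; near: J.
  by move/cvgrPdist_lt : xs; apply.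
by move/cvgrPdist_lt : yt; apply.
Unshelve. all: by end_near. Qed.

(** From [|p + q|^2 <= 2 |p|^2 + 2 |q|^2]. *)
Lemma bessel_dsum u v :
  bessel u -> bessel v -> bessel (fun i => dsum_pair (u i) (v i)).
Proof.
move=> /bessel_bound[B B0 hu] /bessel_bound[C C0 hv].
exists (2 * (B + C)) => -[x y]; apply/esum_leP => [i|J]; first exact: sqr_ge0.
apply: (@le_trans _ _ (2 * \sum_(i <- J) `|⟨u i, x⟩| ^+ 2 +
                       2 * \sum_(i <- J) `|⟨v i, y⟩| ^+ 2)).
  rewrite !mulr_sumr -big_split /=; apply: ler_sum => i _.
  have := ler_normD ⟨u i, x⟩ ⟨v i, y⟩; have := normr_ge0 (⟨u i, x⟩ + ⟨v i, y⟩).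
  rewrite [qinner (dsum_pair _ _) _]/(⟨u i, x⟩ + ⟨v i, y⟩).
  move: `|_ + _| `|⟨u i, x⟩| `|⟨v i, y⟩| => n p q n0 npq.
  have := sqr_ge0 (p - q); nra.
have := hu x J; have := hv y J.
have := dsum_norm_fst (dsum_pair x y); have := dsum_norm_snd (dsum_pair x y).
rewrite /= -[(x, y)]/(dsum_pair x y); have := normr_ge0 x; have := normr_ge0 y.
move: `|x| `|y| `|dsum_pair x y| => p q n q0 p0 qn pn hv' hu'.
have n0 : 0 <= n by exact: le_trans pn.
have : B * p ^+ 2 <= B * n ^+ 2 by rewrite ler_pM2l// ler_pXn2r.
have : C * q ^+ 2 <= C * n ^+ 2 by rewrite ler_pM2l// ler_pXn2r.
lra.
Qed.

(** The two cross terms, [u i :*: <b i, y>] and [v i :*: <a i, x>], are the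
    terms of the series [T1 (theta2 y)] and [T2 (theta1 x)]. *)
Lemma dsum_coef (u a : I -> H1) (v b : I -> H2) x y i :
  dsum_pair (u i) (v i) :*: ⟨dsum_pair (a i) (b i), dsum_pair x y⟩ =
  dsum_pair (u i :*: ⟨a i, x⟩ + u i :*: ⟨b i, y⟩)
            (v i :*: ⟨a i, x⟩ + v i :*: ⟨b i, y⟩).
Proof. by rewrite /dsum_pair -!rscaleDr. Qed.

End DirectSum.

Theorem theorem16 (R : realType) (I : countType) (H1 H2 : quatHilbertType R)
  (K1 : boundedOp H1 H1) (K2 : boundedOp H2 H2)
  (u a : I -> H1) (v b : I -> H2)
  (hu : Kframe K1 u) (ha : Kdual K1 u a)
  (hv : Kframe K2 v) (hb : Kdual K2 v b) :
  let T1 := synthesis u in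
  let T2 := synthesis v in
  let theta1 := frame_transform (bessel_Kdual ha) in
  let theta2 := frame_transform (bessel_Kdual hb) in
  (Kframe (opsum K1 K2) (fun i => dsum_pair (u i) (v i)) /\
   Kdual (opsum K1 K2) (fun i => dsum_pair (u i) (v i)) (fun i => dsum_pair (a i) (b i)))
  <->
  ((forall x : H1, T2 (theta1 x) = 0) /\ (forall y : H2, T1 (theta2 y) = 0)).
Proof.
move=> T1 T2 theta1 theta2; split=> [[_ [_ hK]]|[h21 h12]].
  split=> [x|y]; apply: series_cvg_sum.
    have := hK (dsum_pair x 0).
    under eq_fun do rewrite dsum_coef !qinnerr0 !rscale0 !addr0.
    move=> /(series_cvg_dsum _ _ (K1 x) (K2 0)) [_].
    by rewrite bop0.
  have := hK (dsum_pair 0 y).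
  under eq_fun do rewrite dsum_coef !qinnerr0 !rscale0 !add0r.
  move=> /(series_cvg_dsum _ _ (K1 0) (K2 y)) [+ _].
  by rewrite bop0.
have bu := Kframe_bessel _ _ hu; have bv := Kframe_bessel _ _ hv.
suff hK : Kdual (opsum K1 K2) (fun i => dsum_pair (u i) (v i))
    (fun i => dsum_pair (a i) (b i)).
  by split=> //; apply: Kdual_Kframe hK; exact: bessel_dsum.
split; first exact: bessel_dsum ha.1 hb.1.
case=> x y; under eq_fun do rewrite dsum_coef.
apply/(series_cvg_dsum _ _ (K1 x) (K2 y)); split.
  rewrite -[K1 x]addr0 -(h12 y); apply: series_cvgD (ha.2 x) _.
  exact: synthesis_series_cvg.
rewrite -[K2 y]add0r -(h21 x); apply: series_cvgD (hb.2 y).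
exact: synthesis_series_cvg.
Qed.
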